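(* (Non-conservative case) Let $v_-<v_*<v_+$ be real numbers and let $f$ be a smooth double-well potential which has two local minima at $v_-$ and $v_+$ and one local maximum at $v_*$, with $f'(v)>0$ for $v_-<v<v_*$ and $f'(v)<0$ for $v_*<v<v_+$. Suppose there are positive integers $m_1,m_2$ such that $$f^{(k)}(v_+)=0\ (1\le k\le 2m_1-1),\quad f^{(2m_1)}(v_+)>0,\qquad f^{(k)}(v_-)=0\ (1\le k\le 2m_2-1),\quad f^{(2m_2)}(v_-)>0.$$ Let $T_{11}$ be a given real constant. Then the one-dimensional system $$T_{11}=D^{11}_{11}u^1_{x_1}-(D^{11}:\varepsilon^{(0)})-(D^{11}:\varepsilon^{(1)})v,\qquad v_t=(\alpha T_{11}+\beta-f'(v)+v_{x_1x_1})|v_{x_1}|$$ for $(v,u^1)(x_1,t)$ admits a smooth traveling wave solution $(v,u^1_{x_1})=(v,w)(\xi)$, $\xi=x_1-st$, satisfying $$v(\xi)\to v_\pm,\quad w(\xi)\to w_\pm\quad\text{as }\xi\to\pm\infty,\qquad\text{and}\qquad v_\xi(\xi)>0\ \text{ for all }\xi\in\mathbb R,$$ if and only if the constants $s$, $v_\pm$ and $w_\pm$ satisfy the relations $$s=-(\alpha T_{11}+\beta),\qquad f(v_+)=f(v_-),\qquad D^{11}_{11}(w_+-w_-)=(D^{11}:\varepsilon^{(1)})(v_+-v_-).$$ In particular, the two local minima $f(v_\pm)$ must coincide in this case. Moreover, such a traveling wave solution is unique up to a translation in $\xi$ and verifies the decay estimates $$\big|\partial_\xi^k(v(\xi)-v_+)\big|\le\begin{cases}Ce^{-c|\xi|}&\text{if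 }m_1=1,\\ C(1+|\xi|)^{-\nu_1-k}&\text{if }m_1>1\end{cases}\qquad\text{for }\xi\to+\infty,$$ $$\big|\partial_\xi^k(v(\xi)-v_-)\big|\le\begin{cases}Ce^{-c|\xi|}&\text{if }m_2=1,\\ C(1+|\xi|)^{-\nu_2-k}&\text{if }m_2>1\end{cases}\qquad\text{for }\xi\to-\infty,$$ where $k$ is a non-negative integer, $\nu_1=1/(m_1-1)$, $\nu_2=1/(m_2-1)$, and $C$ and $c$ are positive constants.
   Context: $\mathcal S^n$ is the space of real symmetric $n\times n$ matrices, with scalar product $\sigma:\tau=\sum_{i,j=1}^n\sigma_{ij}\tau_{ij}$ and norm $|\sigma|=(\sigma:\sigma)^{1/2}$. $D=(D^{ij}_{kl})$ is a linear, symmetric, positive definite operator $\mathcal S^n\to\mathcal S^n$, acting by $(D\sigma)_{ij}=\sum_{k,l=1}^nD^{ij}_{kl}\sigma_{kl}$, with $(D\sigma):\sigma\ge c_0|\sigma|^2$ for some constant $c_0>0$. For fixed $(i,j)$, $D^{ij}=(D^{ij}_{kl})_{k,l}\in\mathcal S^n$; and $D_{11}=(D^{ij}_{11})_{i,j}\in\mathcal S^n$. $\varepsilon^{(0)},\varepsilon^{(1)}\in\mathcal S^n$ are given constant matrices. The constants $\alpha,\beta$ are $$\alpha=\frac{1}{D^{11}_{11}}(D_{11}:\varepsilon^{(1)}),\qquad \beta=\frac{1}{D^{11}_{11}}\Big\{(D_{11}:\varepsilon^{(1)})(D^{11}:\varepsilon^{(0)})-D^{11}_{11}(D\varepsilon^{(0)}:\varepsilon^{(1)})\Big\}.$$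 For functions of the traveling wave form $v=v(x_1-st)$, $u^1_{x_1}=w(x_1-st)$ with constant velocity $s$, the system reads $$T_{11}=D^{11}_{11}w-(D^{11}:\varepsilon^{(0)})-(D^{11}:\varepsilon^{(1)})v,\qquad -sv_\xi=(\alpha T_{11}+\beta-f'(v)+v_{\xi\xi})|v_\xi|\quad(\xi\in\mathbb R).$$
   Formalization: The relations also include T_11 = D^{11}_{11}w_- − (D^{11}:ε^(0)) − (D^{11}:ε^(1))v_-; without it, adding one constant to both w_± keeps the three printed relations but no wave with these limits exists. *)

(* Defs.v *)
From HB Require Import structures.
From mathcomp Require Import all_boot all_order all_algebra.
From mathcomp Require Import all_classical all_reals all_analysis.

Set Implicit Arguments.
Unset Strict Implicit.
Unset Printing Implicit Defensive.

Import Order.TTheory GRing.Theory Num.Theory.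
Import numFieldNormedType.Exports.

Local Open Scope ring_scope.
Local Open Scope classical_set_scope.

(* The space dimension is n.+1 >= 1, and the index 1 of the tensor components
   D^{11}_{11}, D^{11}, D_{11}, u^1, x_1 is ord0 : 'I_n.+1. *)

Section Tensors.
Variables (R : realType) (n : nat).
Implicit Types (sigma tau : 'M[R]_n.+1).

Definition symmx sigma : Prop := sigma^T = sigma.

Definition ddot sigma tau : R := \sum_i \sum_j sigma i j * tau i j.

Definition frob sigma : R := Num.sqrt (ddot sigma sigma).

(* D i j is the matrix D^{ij}, so that D i j k l is D^{ij}_{kl}. *)
Definition tensor4 := 'I_n.+1 -> 'I_n.+1 -> 'M[R]_n.+1.

Definition tapp (D : tensor4) sigma : 'M[R]_n.+1 :=
  \matrix_(i, j) \sum_k \sum_l D i j k l * sigma k l.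

Record elastic_tensor (D : tensor4) : Prop := ElasticTensor {
  elastic_row_sym : forall i j, symmx (D i j) ;
  elastic_stable : forall sigma, symmx sigma -> symmx (tapp D sigma) ;
  elastic_selfadj : forall sigma tau, symmx sigma -> symmx tau ->
    ddot (tapp D sigma) tau = ddot sigma (tapp D tau) ;
  elastic_coercive : exists2 c0 : R, 0 < c0 &
    forall sigma, symmx sigma ->
      c0 * frob sigma ^+ 2 <= ddot (tapp D sigma) sigma }.

Definition Dup11 (D : tensor4) : 'M[R]_n.+1 := D ord0 ord0.

Definition Dlow11 (D : tensor4) : 'M[R]_n.+1 :=
  \matrix_(i, j) D i j ord0 ord0.

Definition D1111 (D : tensor4) : R := D ord0 ord0 ord0 ord0.

Definition alpha (D : tensor4) (eps1 : 'M[R]_n.+1) : R :=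
  (D1111 D)^-1 * ddot (Dlow11 D) eps1.

Definition beta (D : tensor4) (eps0 eps1 : 'M[R]_n.+1) : R :=
  (D1111 D)^-1 *
  (ddot (Dlow11 D) eps1 * ddot (Dup11 D) eps0
   - D1111 D * ddot (tapp D eps0) eps1).

Definition stress11 (D : tensor4) (eps0 eps1 : 'M[R]_n.+1) (w v : R) : R :=
  D1111 D * w - ddot (Dup11 D) eps0 - ddot (Dup11 D) eps1 * v.

End Tensors.

Section Waves.
Variable R : realType.

Definition smooth (g : R -> R) : Prop :=
  forall (k : nat) (x : R), derivable (derive1n k g) x 1.

Definition local_min (g : R -> R) (a : R) : Prop := \forall x \near a, g a <= g x.

Definition local_max (g : R -> R) (a : R) : Prop := \forall x \near a, g x <= g a.

Record double_well (f : R -> R) (vm vs vp : R) : Prop := DoubleWell {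
  dw_smooth : smooth f ;
  dw_min_left : local_min f vm ;
  dw_min_right : local_min f vp ;
  dw_max : local_max f vs ;
  dw_incr : forall v, vm < v < vs -> 0 < derive1 f v ;
  dw_decr : forall v, vs < v < vp -> derive1 f v < 0 }.

Definition flat_min (f : R -> R) (a : R) (m : nat) : Prop :=
  (forall k : nat, (1 <= k <= 2 * m - 1)%N -> derive1n k f a = 0)
  /\ 0 < derive1n (2 * m)%N f a.

Definition dx (g : R -> R -> R) (x t : R) : R := derive1 (fun y => g y t) x.

Definition dt (g : R -> R -> R) (x t : R) : R := derive1 (fun r => g x r) t.

Definition solves_system (n : nat) (D : tensor4 R n) (eps0 eps1 : 'M[R]_n.+1)
    (f : R -> R) (T11 : R) (v u1 : R -> R -> R) : Prop :=
  forall x t : R,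
    T11 = stress11 D eps0 eps1 (dx u1 x t) (v x t) /\
    dt v x t = (alpha D eps1 * T11 + beta D eps0 eps1 - derive1 f (v x t)
                + dx (dx v) x t) * `|dx v x t|.

(* The system involves the displacement u^1 only through its x_1-derivative,
   and it is that derivative, not u^1 itself, which is a traveling wave. *)
Record traveling_wave (n : nat) (D : tensor4 R n) (eps0 eps1 : 'M[R]_n.+1)
    (f : R -> R) (T11 s : R) (v w : R -> R) : Prop := TravelingWave {
  tw_smooth_v : smooth v ;
  tw_smooth_w : smooth w ;
  tw_solves : exists u1 : R -> R -> R,
    (forall x t : R, is_derive x (1 : R) (fun y => u1 y t) (w (x - s * t))) /\
    solves_system D eps0 eps1 f T11 (fun x t => v (x - s * t)) u1 }.

Record monotone_front (vm vp wm wp : R) (v w : R -> R) : Prop := MonotoneFront {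
  mf_v_left : v xi @[xi --> -oo] --> vm ;
  mf_v_right : v xi @[xi --> +oo] --> vp ;
  mf_w_left : w xi @[xi --> -oo] --> wm ;
  mf_w_right : w xi @[xi --> +oo] --> wp ;
  mf_incr : forall xi : R, 0 < derive1 v xi }.

(* The bounds hold in a neighbourhood of infinity described by the filter F.
   The exponential rate c is uniform in k, while C depends on k. *)
Definition exp_decay (F : set_system R) (g : R -> R) : Prop :=
  exists2 c : R, 0 < c & forall k : nat, exists2 C : R, 0 < C &
    \forall xi \near F, `|derive1n k g xi| <= C * expR (- (c * `|xi|)).

Definition alg_decay (F : set_system R) (nu : R) (g : R -> R) : Prop :=
  forall k : nat, exists2 C : R, 0 < C &
    \forall xi \near F, `|derive1n k g xi| <= C * (1 + `|xi|) `^ (- nu - k%:R).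

Definition front_decay (F : set_system R) (m : nat) (g : R -> R) : Prop :=
  (m = 1%N -> exp_decay F g) /\
  ((1 < m)%N -> alg_decay F ((m%:R - 1)^-1) g).

End Waves.

(* Main.v *)
Require Import Defs.
From HB Require Import structures.
From mathcomp Require Import all_boot all_order all_algebra.
From mathcomp Require Import all_classical all_reals all_analysis.
From mathcomp Require Import ring lra zify.

Set Implicit Arguments.
Unset Strict Implicit.
Unset Printing Implicit Defensive.

Import Order.TTheory GRing.Theory Num.Theory.
Import numFieldNormedType.Exports.

Local Open Scope ring_scope.
Local Open Scope classical_set_scope.

(** With u^1_{x_1} = w(x_1 - s t) the first equation makes w an affine function
of v, and since v' > 0 the factor |v'| cancels from the second one, which
becomes the Newton equation v'' = f'(v) - sigma, where
sigma = s + alpha T11 + beta.  The whole theorem is a study of this equation.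

Relations between the constants ([front_first_integral]).  The energy
v'^2 / 2 - f(v) + sigma v is constant, so v', being positive, has a limit at
both ends; this limit is 0 because v itself converges.  Then v'' also converges
at +oo, to -sigma since f'(v_+) = 0, and for the same reason this limit is 0.
Hence sigma = 0, and equating the energies of the two ends gives
f(v_+) = f(v_-).

Existence and uniqueness ([autonomous_exists], [autonomous_unique]).  The energy
relation now reads v' = q(v) with q(y) = sqrt(2 (f(y) - f(v_-))), a first order
autonomous equation.  The shape of the double well makes q positive on
]v_-, v_+[, so a primitive G of 1/q measures travel time: the fronts are exactly
the solutions of G(v(xi)) = xi + constant, which proves uniqueness up to a
translation.  As f' vanishes at both wells, q is at most linear there, so G
covers the whole real line and its inverse is a front defined for all xi.  The
front is smooth because v'' = f'(v) can be differentiated again and again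
([ode_smooth]).

Decay ([front_tail_decay]).  Let p > 0 be the distance of v to the well,
followed towards the end of the line, let g(p) = f(v) - f(v_well), and let 2m be
the order of the first nonzero derivative of f at the well.  By Taylor's formula
g(p) is comparable to p^(2m), hence -p' = sqrt(2 g(p)) is comparable to p^m:
this forces exponential decay when m = 1, and makes p^(1-m) grow at least
linearly when m > 1.  Each derivative costs a factor p^(m-1): the k-th
derivative of p is O(p^(1 + k (m-1))).  This single bound, in which only natural
exponents occur, contains both decay rates of the theorem, and it is proved by
one induction on the equation p'' = g'(p) ([deriv_bound_ode]).  The two ends of
the line are handled together by reflecting the values and the variable. *)

(** * Calculus on the line *)

(** The derivation rules are restated for explicit lambda abstractions, the form
in which functions occur below, so that derivatives can be computed by composing
proof terms. *)
Lemma is_derive1_cst (R : realType) (x c : R) :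
  is_derive x 1 (fun=> c) (0 : R).
Proof. exact: is_derive_cst. Qed.

Lemma is_derive1_idfun (R : realType) (x : R) :
  is_derive x 1 (fun y => y) (1 : R).
Proof. exact: is_derive_id. Qed.

Lemma is_derive1D (R : realType) (f g : R -> R) (x a b : R) :
  is_derive x 1 f a -> is_derive x 1 g b ->
  is_derive x 1 (fun y => f y + g y) (a + b).
Proof. by move=> fa gb; apply: is_deriveD. Qed.

Lemma is_derive1N (R : realType) (f : R -> R) (x a : R) :
  is_derive x 1 f a -> is_derive x 1 (fun y => - f y) (- a).
Proof. by move=> fa; apply: is_deriveN. Qed.

Lemma is_derive1M (R : realType) (f g : R -> R) (x a b : R) :
  is_derive x 1 f a -> is_derive x 1 g b ->
  is_derive x 1 (fun y => f y * g y) (a * g x + f x * b).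
Proof.
move=> fa gb; rewrite addrC [a * _]mulrC.
exact: (@is_deriveM _ _ f g x 1 a b).
Qed.

Lemma is_derive1_cmp (R : realType) (f g : R -> R) (x a b : R) :
  is_derive (g x) 1 f a -> is_derive x 1 g b ->
  is_derive x 1 (fun y => f (g y)) (a * b).
Proof. by move=> fa gb; apply: is_derive1_comp. Qed.

Lemma is_derive1X (R : realType) (f : R -> R) (n : nat) (x a : R) :
  is_derive x 1 f a ->
  is_derive x 1 (fun y => f y ^+ n) (n%:R * f x ^+ n.-1 * a).
Proof. move=> fa; rewrite -exprfctE.
exact: (@is_deriveX _ _ f n x 1 a). Qed.

Lemma is_derive1V (R : realType) (f : R -> R) (x a : R) : f x != 0 ->
  is_derive x 1 f a -> is_derive x 1 (fun y => (f y)^-1) (- (f x) ^- 2 * a).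
Proof. by move=> fx fa; exact: (@is_deriveV _ f x a 1). Qed.

Lemma is_derive1_linear (R : realType) (c x : R) :
  is_derive x 1 (fun y => c * y) c.
Proof.
have := is_derive1M (is_derive1_cst x c) (is_derive1_idfun x).
by rewrite mul0r add0r mulr1.
Qed.

Lemma is_derive1_val (R : realType) (f : R -> R) (x a : R) :
  is_derive x 1 f a -> derive1 f x = a.
Proof. by move=> fa; rewrite derive1E; exact: derive_val. Qed.

Lemma derivable_is_derive1 (R : realType) (f : R -> R) (x : R) :
  derivable f x 1 -> is_derive x 1 f (derive1 f x).
Proof. by rewrite derive1E => /derivableP. Qed.

Lemma is_derive1_derivable (R : realType) (f : R -> R) (x a : R) :
  is_derive x 1 f a -> derivable f x 1.
Proof. by case. Qed.

Lemma is_derive1_continuous (R : realType) (f : R -> R) (x a : R) :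
  is_derive x 1 f a -> {for x, continuous f}.
Proof.
by case=> fx _; apply/differentiable_continuous/derivable1_diffP.
Qed.

Lemma mean_value (R : realType) (f df : R -> R) (a b : R) : a < b ->
  (forall x, a <= x <= b -> is_derive x 1 f (df x)) ->
  exists2 c, a < c < b & f b - f a = df c * (b - a).
Proof.
move=> ab fd.
have [||c] := @MVT _ f df a b ab.
- move=> x; rewrite in_itv/= => /andP[/ltW ax /ltW xb].
  by apply: fd; rewrite ax.
- apply: derivable_within_continuous => x; rewrite in_itv/= => xab.
  exact: is_derive1_derivable (fd x xab).
by rewrite in_itv/= => cab e; exists c.
Qed.

Lemma derive_ge0_le (R : realType) (f df : R -> R) (a b : R) : a <= b ->
  (forall x, a <= x <= b -> is_derive x 1 f (df x)) ->
  (forall x, a < x < b -> 0 <= df x) -> f a <= f b.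
Proof.
rewrite le_eqVlt => /predU1P[->//|ab] fd df0.
have [c cab e] := mean_value ab fd.
by rewrite -subr_ge0 e mulr_ge0 ?df0// subr_ge0 ltW.
Qed.

Lemma derive_gt0_lt (R : realType) (f df : R -> R) (a b : R) : a < b ->
  (forall x, a <= x <= b -> is_derive x 1 f (df x)) ->
  (forall x, a < x < b -> 0 < df x) -> f a < f b.
Proof.
move=> ab fd df0; have [c cab e] := mean_value ab fd.
by rewrite -subr_gt0 e mulr_gt0 ?df0// subr_gt0.
Qed.

Lemma near_pinftyP (R : realType) (P : R -> Prop) :
  (\forall x \near +oo, P x) <-> exists a : R, forall x, a <= x -> P x.
Proof.
split=> [[a [_ aP]]|[a aP]].
  by exists (a + 1) => x ax; apply: aP; rewrite (lt_le_trans _ ax)// ltrDl.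
by exists a; split; [exact: num_real|move=> x /ltW; exact: aP].
Qed.

(** A function given along with all its derivatives. Translating, reflecting and
scaling a smooth function are then operations on the whole family, and no
iterated derivative has to be computed. *)
Definition derivative_tower {R : realType} (h : nat -> R -> R) : Prop :=
  forall k x, is_derive x (1 : R) (h k) (h k.+1 x).

Lemma tower_continuous (R : realType) (h : nat -> R -> R) :
  derivative_tower h -> forall k, continuous (h k).
Proof. by move=> hT k x; exact: is_derive1_continuous (hT k x). Qed.

Lemma smooth_tower (R : realType) (f : R -> R) :
  smooth f -> derivative_tower (fun k => f^`(k)).
Proof. by move=> fs k x; apply: derivable_is_derive1; exact: fs. Qed.

Lemma tower_derive1n (R : realType) (h : nat -> R -> R) :
  derivative_tower h -> forall k, (h 0%N)^`(k) = h k.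
Proof.
move=> hT; elim=> [//|k IH]; rewrite derive1nS IH.
by apply/funext => x; exact: is_derive1_val (hT k x).
Qed.

Lemma tower_smooth (R : realType) (h : nat -> R -> R) :
  derivative_tower h -> smooth (h 0%N).
Proof.
move=> hT k x; rewrite tower_derive1n//.
exact: is_derive1_derivable (hT k x).
Qed.

Lemma tower_affine_arg (R : realType) (h : nat -> R -> R) (s a : R) :
  derivative_tower h -> derivative_tower (fun j y => s ^+ j * h j (a + s * y)).
Proof.
move=> hT j y.
have lin := is_derive1D (is_derive1_cst y a) (is_derive1_linear s y).
have hl := @is_derive1_cmp _ (h j) (fun y => a + s * y) _ _ _ (hT j _) lin.
apply: (is_derive_eq (is_derive1M (is_derive1_cst y (s ^+ j)) hl)).
by rewrite mul0r !add0r exprSr -mulrA [_ * s]mulrC.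
Qed.

Lemma tower_affine_value (R : realType) (h : nat -> R -> R) (s c : R) :
  derivative_tower h ->
  derivative_tower (fun j y => s * h j y + (if j is 0%N then c else 0)).
Proof.
move=> hT j y; have sh := is_derive1M (is_derive1_cst y s) (hT j y).
apply: (is_derive_eq (is_derive1D sh (is_derive1_cst y _))).
by rewrite mul0r add0r.
Qed.

(** * Functions whose derivatives gain a fixed order *)

(** An abstract version of the statement that a is O(p^j) for a small p: only
these closure properties enter the induction on derivatives. The trivial
predicate is another instance, and turns the same induction into a proof of
smoothness. *)
Record graded_bound {R : realType} (B : nat -> (R -> R) -> Prop) : Prop :=
  GradedBound {
  gb_add : forall j a b, B j a -> B j b -> B j (fun x => a x + b x) ;
  gb_mul : forall i j a b, B i a -> B j b -> B (i + j)%N (fun x => a x * b x) ;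
  gb_le : forall i j a, (i <= j)%N -> B j a -> B i a }.

Section DerivBound.
Context {R : realType} (B : nat -> (R -> R) -> Prop) (e : nat).

(** Recursion on the derivative of a, instead of a quantification over all orders
of differentiation, lets the product rule do the work of the general Leibniz
formula in the inductions below. *)
Fixpoint deriv_bound (N j : nat) (a : R -> R) : Prop :=
  B j a /\ if N is N'.+1 then
    (forall x : R, derivable a x 1) /\ deriv_bound N' (j + e) (derive1 a)
  else True.

Context (gB : graded_bound B).

Lemma deriv_boundW N i j a : (i <= j)%N ->
  deriv_bound N j a -> deriv_bound N i a.
Proof.
elim: N i j a => [|N IH] i j a ij /= [Ba aN].
  by split=> //; exact: gb_le ij Ba.
case: aN => da aN; split; first exact: gb_le ij Ba.
by split=> //; apply: IH aN; rewrite leq_add2r.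
Qed.

Lemma deriv_bound_pred N j a :
  deriv_bound N.+1 j a -> deriv_bound N j a.
Proof.
elim: N j a => [|N IH] j a [Ba [da aN]]; first by split.
by split=> //; split=> //; exact: IH.
Qed.

Lemma deriv_bound_add N j a b : deriv_bound N j a ->
  deriv_bound N j b -> deriv_bound N j (fun x => a x + b x).
Proof.
elim: N j a b => [|N IH] j a b [Ba aN] [Bb bN] /=.
  by split=> //; exact: gb_add.
case: aN bN => da aN [db bN]; split; first exact: gb_add.
have ab (x : R) :
    is_derive x 1 (fun x => a x + b x) (derive1 a x + derive1 b x).
  by apply: is_derive1D; exact: derivable_is_derive1.
split; first by move=> x; exact: is_derive1_derivable (ab x).
rewrite (_ : derive1 _ = fun x => derive1 a x + derive1 b x); first exact: IH.
by apply/funext => x; exact: is_derive1_val (ab x).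
Qed.

(** By the Leibniz rule: in each term the derivative falls on one factor and
raises the order of the product by e. *)
Lemma deriv_bound_mul N i j a b : deriv_bound N i a ->
  deriv_bound N j b -> deriv_bound N (i + j) (fun x => a x * b x).
Proof.
elim: N i j a b => [|N IH] i j a b aN1 bN1 /=.
  by case: aN1 bN1 => Ba _ [Bb _]; split=> //; exact: gb_mul.
have aN0 := deriv_bound_pred aN1; have bN0 := deriv_bound_pred bN1.
case: aN1 bN1 => Ba [da aN] [Bb [db bN]]; split; first exact: gb_mul.
have ab (x : R) : is_derive x 1 (fun x => a x * b x)
    (derive1 a x * b x + a x * derive1 b x).
  by apply: is_derive1M; exact: derivable_is_derive1.
split; first by move=> x; exact: is_derive1_derivable (ab x).
rewrite (_ : derive1 _ = fun x => derive1 a x * b x + a x * derive1 b x);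
    last first.
  by apply/funext => x; exact: is_derive1_val (ab x).
apply: deriv_bound_add; first by rewrite addnAC; exact: IH.
by rewrite -addnA; exact: IH.
Qed.

(** The derivative of h j (v) is h j.+1 (v) * v'. Differentiating h loses at
most one order, while v' has order 1 + e, so that the product gains e orders. *)
Lemma deriv_bound_comp N h (wt : nat -> nat) v : derivative_tower h ->
  (forall j, wt j <= (wt j.+1).+1)%N ->
  (forall j, B (wt j) (fun x => h j (v x))) ->
  deriv_bound N 1 v ->
  forall j, deriv_bound N (wt j) (fun x => h j (v x)).
Proof.
move=> hT wtS Bh; elim: N => [|N IH] vN j; first by split.
split=> //; have vN0 := deriv_bound_pred vN; case: vN => Bv [dv vN].
have hv (x : R) :
    is_derive x 1 (fun x => h j (v x)) (h j.+1 (v x) * derive1 v x).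
  by apply: is_derive1_cmp; [exact: hT|exact: derivable_is_derive1].
split; first by move=> x; exact: is_derive1_derivable (hv x).
rewrite (_ : derive1 _ = fun x => h j.+1 (v x) * derive1 v x); last first.
  by apply/funext => x; exact: is_derive1_val (hv x).
apply: (@deriv_boundW _ _ (wt j.+1 + (1 + e))%N); last first.
  by apply: deriv_bound_mul => //; exact: IH.
by rewrite addnA addn1 leq_add2r.
Qed.

(** A bound on N derivatives of v passes through the right-hand side of
v'' = h 0 (v), and so becomes a bound on N + 2 derivatives. The condition on
wt 0 says that the order of h 0 (v) is that expected of a second derivative. *)
Lemma deriv_bound_ode h (wt : nat -> nat) v dv : derivative_tower h ->
  (forall j, wt j <= (wt j.+1).+1)%N -> (1 + e + e <= wt 0)%N ->
  (forall j, B (wt j) (fun x => h j (v x))) ->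
  (forall x : R, is_derive x 1 v (dv x)) ->
  (forall x : R, is_derive x 1 dv (h 0%N (v x))) ->
  B 1%N v -> B (1 + e)%N dv ->
  forall N, deriv_bound N 1 v.
Proof.
move=> hT wtS wt0 Bh vd dvd Bv Bdv; elim=> [//|N IH].
apply: deriv_bound_pred; split=> //; split.
  by move=> x; exact: is_derive1_derivable (vd x).
rewrite (_ : derive1 v = dv); last first.
  by apply/funext => x; exact: is_derive1_val (vd x).
split=> //; split; first by move=> x; exact: is_derive1_derivable (dvd x).
rewrite (_ : derive1 dv = fun x => h 0%N (v x)); last first.
  by apply/funext => x; exact: is_derive1_val (dvd x).
apply: deriv_boundW wt0 _; exact: deriv_bound_comp.
Qed.

Lemma deriv_bound_derive1n N j a k : (k <= N)%N ->
  deriv_bound N j a -> B (j + k * e)%N a^`(k).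
Proof.
elim: N j a k => [|N IH] j a [|k] // kN [Ba aN]; rewrite ?addn0//.
by rewrite derive1Sn mulSn addnA; apply: IH => //; case: aN.
Qed.

Lemma deriv_bound_smooth j a : (forall N, deriv_bound N j a) -> smooth a.
Proof.
move=> aN k x; have {}aN := aN k.+1.
elim: k j a aN x => [|k IH] j a [_ [da aN]] x; first exact: da.
by rewrite derive1Sn; exact: IH aN x.
Qed.

End DerivBound.

Lemma ode_smooth (R : realType) (h : nat -> R -> R) (v dv : R -> R) :
  derivative_tower h ->
  (forall x : R, is_derive x 1 v (dv x)) ->
  (forall x : R, is_derive x 1 dv (h 0%N (v x))) -> smooth v.
Proof.
move=> hT vd dvd.
have gB : @graded_bound R (fun _ _ => True) by [].
apply: (@deriv_bound_smooth _ _ 0%N 1%N) => N.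
exact: (@deriv_bound_ode _ _ _ gB h (fun=> 1%N) v dv).
Qed.

(** * Taylor bounds at a flat point *)

(** Taylor's inequality at a point where h 0 vanishes to order n. *)
Lemma tower_ge_pow (R : realType) (h : nat -> R -> R) (n : nat) (c d : R) :
  derivative_tower h -> (forall k, (k < n)%N -> h k 0 = 0) ->
  (forall x : R, 0 <= x <= d -> c <= h n x) ->
  forall x : R, 0 <= x <= d -> c / n`!%:R * x ^+ n <= h 0%N x.
Proof.
elim: n h => [|n IH] h hT h0 hc x xd.
  by rewrite fact0 divr1 expr0 mulr1; exact: hc.
have /IH : derivative_tower (fun k => h k.+1) by move=> k y; exact: hT.
have h'0 k : (k < n)%N -> h k.+1 0 = 0 by move=> kn; apply: h0.
move=> /(_ h'0 hc) {h'0} h1.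
rewrite -subr_ge0.
pose g y := h 0%N y - c / n.+1`!%:R * y ^+ n.+1.
have g0 : g 0 = 0 by rewrite /g h0// expr0n mulr0 subr0.
rewrite -/(g x) -g0.
case/andP: xd => x0 xd.
apply: (@derive_ge0_le _ _ (fun y => h 1%N y - c / n`!%:R * y ^+ n)) => //.
  move=> y _; apply: is_derive1D; first exact: hT.
  apply: is_derive1N; apply: is_derive_eq.
    by apply: is_derive1M; apply: is_derive1X; exact: is_derive1_idfun.
  rewrite mul0r add0r mulr1 factS natrM /=.
  have n1 : n.+1%:R != 0 :> R by rewrite pnatr_eq0.
  have n2 : n`!%:R != 0 :> R by rewrite pnatr_eq0 -lt0n fact_gt0.
  by field; rewrite ?natr1 ?nat1r n1 n2.
move=> y /andP[y0 yx]; rewrite subr_ge0; apply: h1.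
by rewrite ltW// (le_trans (ltW yx)).
Qed.

(** The truncated subtraction in the exponent covers the derivatives of order
beyond n as well, which are only bounded. *)
Lemma tower_flat_bound (R : realType) (h : nat -> R -> R) (n : nat) :
  derivative_tower h -> (forall k, (k < n)%N -> h k 0 = 0) ->
  forall j, exists M d, [/\ 0 < M, 0 < d &
    forall x : R, 0 <= x <= d -> `|h j x| <= M * x ^+ (n - j)].
Proof.
move=> hT h0 j; pose N := maxn j n; pose M := `|h N 0| + 1.
have M0 : 0 < M by rewrite ltr_wpDl.
have [e /= e0 he] : \forall x \near (0 : R), `|h N x| < M.
  have := @tower_continuous _ _ hT N 0.
  move=> /(cvg_norm (f := h N)) /cvgrPdist_lt /(_ 1 ltr01).
  apply: filterS => x; rewrite /M ltr_norml; lra.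
(* e / 2, so as to stay inside the open ball given by continuity *)
have hM x : 0 <= x <= e / 2 -> `|h N x| <= M.
  move=> /andP[x0 xe]; apply/ltW/he; rewrite /ball_/= sub0r normrN ger0_norm//.
  by rewrite (le_lt_trans xe)// ltr_pdivrMr// mulr_natr mulr2n ltrDl.
exists M, (e / 2); split=> //; first exact: divr_gt0.
have [jn|nj] := leqP n j.
  move=> x xe; rewrite (eqP (_ : n - j == 0)%N) ?subn_eq0// expr0 mulr1.
  by move: (hM x xe); rewrite /N (maxn_idPl jn).
have Nn : N = n by rewrite /N (maxn_idPr (ltnW nj)).
have sT : derivative_tower (fun k => h (k + j)%N) by move=> k x; exact: hT.
have nT : derivative_tower (fun k x => - h (k + j)%N x).
  by move=> k x; apply: is_derive1N; exact: hT.
have s0 k : (k < n - j)%N -> h (k + j)%N 0 = 0.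
  by move=> kn; apply: h0; rewrite addnC -ltn_subRL.
have n0 k : (k < n - j)%N -> - h (k + j)%N 0 = 0.
  by move=> kn; rewrite s0// oppr0.
have sM x : 0 <= x <= e / 2 -> - M <= h (n - j + j)%N x.
  by move=> /hM; rewrite Nn subnK ?(ltnW nj)// ler_norml => /andP[].
have nM x : 0 <= x <= e / 2 -> - M <= - h (n - j + j)%N x.
  by move=> /hM; rewrite Nn subnK ?(ltnW nj)// ler_norml lerN2 => /andP[].
move=> x xe.
have := tower_ge_pow nT n0 nM xe; have := tower_ge_pow sT s0 sM xe.
rewrite !add0n.
have : M / (n - j)`!%:R * x ^+ (n - j) <= M * x ^+ (n - j).
  case/andP: xe => x0 _; rewrite ler_wpM2r ?exprn_ge0// ler_pdivrMr.
    by apply: ler_peMr; [exact: ltW|rewrite ler1n fact_gt0].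
  by rewrite ltr0n fact_gt0.
rewrite !mulNr ler_norml; lra.
Qed.

Lemma tower_flat_lower (R : realType) (h : nat -> R -> R) (n : nat) :
  derivative_tower h -> (forall k, (k < n)%N -> h k 0 = 0) -> 0 < h n 0 ->
  exists c d, [/\ 0 < c, 0 < d &
    forall x : R, 0 <= x <= d -> c * x ^+ n <= h 0%N x].
Proof.
move=> hT h0 hn.
have [e /= e0 he] : \forall x \near (0 : R), h n 0 / 2 < h n x.
  have := @tower_continuous _ _ hT n 0.
  move=> /cvgrPdist_lt /(_ (h n 0 / 2)); rewrite divr_gt0// => /(_ isT).
  apply: filterS => x; rewrite ltr_norml; lra.
exists (h n 0 / 2 / n`!%:R), (e / 2); split; first 2 last.
- apply: tower_ge_pow => // x /andP[x0 xe].
  apply/ltW/he; rewrite /ball_/= sub0r normrN ger0_norm//; lra.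
- by rewrite !divr_gt0// ltr0n fact_gt0.
- exact: divr_gt0.
Qed.

(** * Decay of a trajectory that comes to rest *)

Section Decay.
Context {R : realType} (h : nat -> R -> R) (p dp : R -> R) (m : nat).
Context (hT : derivative_tower h) (m0 : (0 < m)%N).
Context (h0 : forall k, (k < 2 * m)%N -> h k 0 = 0) (hpos : 0 < h (2 * m)%N 0).
Context (pd : forall x : R, is_derive x 1 p (dp x)).
Context (dpd : forall x : R, is_derive x 1 dp (h 1%N (p x))).
Context (p_gt0 : forall x, 0 < p x) (dp_lt0 : forall x, dp x < 0).
Context (energy : forall x, dp x ^+ 2 = 2 * h 0%N (p x)).
Context (p_cvg : p x @[x --> +oo] --> (0 : R)).

Lemma near_small (d : R) : 0 < d -> \forall x \near +oo, 0 <= p x <= d.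
Proof.
move=> d0; move/cvgrPdist_lt : p_cvg => /(_ _ d0); apply: filterS => x.
by rewrite sub0r normrN (gtr0_norm (p_gt0 x)) (ltW (p_gt0 x)) => /ltW.
Qed.

Definition bigO_pow (j : nat) (a : R -> R) : Prop :=
  exists2 C : R, 0 < C & \forall x \near +oo, `|a x| <= C * p x ^+ j.

Lemma bigO_pow_graded : graded_bound bigO_pow.
Proof.
split.
- move=> j a b [C C0 aC] [D D0 bD]; exists (C + D); first exact: addr_gt0.
  near=> x; rewrite mulrDl (le_trans (ler_normD _ _))// lerD//.
    by near: x.
  by near: x.
- move=> i j a b [C C0 aC] [D D0 bD]; exists (C * D); first exact: mulr_gt0.
  near=> x; rewrite normrM exprD mulrACA ler_pM//.
    by near: x.
  by near: x.
- move=> i j a ij [C C0 aC]; exists C => //.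
  near=> x; apply: (@le_trans _ _ (C * p x ^+ j)); first by near: x.
  rewrite ler_pM2l//.
  have /andP[px0 px1] : 0 <= p x <= 1 by near: x; exact: near_small.
  exact: ler_wiXn2l.
Unshelve. all: by end_near. Qed.

Lemma bigO_pow_tower j : bigO_pow (2 * m - j) (fun x => h j (p x)).
Proof.
have [M [d [M0 d0 hM]]] := tower_flat_bound hT h0 j.
by exists M => //; apply: filterS (near_small d0) => x; exact: hM.
Qed.

(** The energy relation bounds dp^2 by a multiple of p^(2m). *)
Lemma bigO_pow_speed : bigO_pow m dp.
Proof.
have [C C0 hC] := bigO_pow_tower 0; exists (1 + 2 * C).
  by rewrite addr_gt0// mulr_gt0.
apply: filterS hC => x; rewrite subn0 => hC.
have pm0 : 0 <= p x ^+ m by rewrite exprn_ge0// ltW.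
rewrite -ler_sqr ?nnegrE//; last first.
  by rewrite mulr_ge0// addr_ge0// mulr_ge0// ltW.
rewrite real_normK ?num_real// energy.
have hC' : h 0%N (p x) <= C * (p x ^+ m) ^+ 2.
  by rewrite -exprM mulnC (le_trans (ler_norm _)).
rewrite (le_trans (ler_wpM2l _ hC'))// exprMn mulrA ler_wpM2r ?sqr_ge0//.
nra.
Qed.

(** The force h 1 (p) has order 2m - 1 = 1 + 2 (m - 1), which is what the second
derivative of a function of order 1 should have when each derivative gains
m - 1 orders. *)
Lemma bigO_pow_derivatives k : bigO_pow (1 + k * (m - 1)) (derive1n k p).
Proof.
have hT' : derivative_tower (fun k => h k.+1) by move=> j x; exact: hT.
apply: (deriv_bound_derive1n (leqnn k)).
apply: (deriv_bound_ode bigO_pow_graded (wt := fun j => (2 * m - j.+1)%N) hT')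
  => [j||j||].
- lia.
- lia.
- exact: bigO_pow_tower.
- exists 1 => //; apply: nearW => x.
  by rewrite mul1r expr1 ger0_norm// ltW.
- by rewrite subnKC//; exact: bigO_pow_speed.
Qed.

(** Positivity of the first nonzero derivative of h makes 2 h 0 (p), which is
dp^2, at least a multiple of p^(2m). *)
Lemma speed_lower :
  exists c a : R, 0 < c /\ forall x, a <= x -> c * p x ^+ m <= - dp x.
Proof.
have [c [d [c0 d0 hc]]] := tower_flat_lower hT h0 hpos.
exists (Num.sqrt c).
have [a ad] : exists a : R, forall x, a <= x -> 0 <= p x <= d.
  exact/near_pinftyP/near_small.
exists a; split=> [|x /ad pxd]; first by rewrite sqrtr_gt0.
have pm0 : 0 <= p x ^+ m by rewrite exprn_ge0// ltW.
have dp0 : 0 <= - dp x by rewrite oppr_ge0 ltW.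
rewrite -ler_sqr ?nnegrE ?mulr_ge0// exprMn sqr_sqrtr ?(ltW c0)//.
rewrite sqrrN energy -exprM (mulnC m 2%N).
have := hc _ pxd.
have : 0 <= c * p x ^+ (2 * m) by rewrite mulr_ge0 ?exprn_ge0// ltW.
lra.
Qed.

(** For m = 1, dp <= - c p, so p x * expR (c x) decreases; all derivatives are
O(p), whence a rate common to all of them. *)
Lemma exp_decay_front : m = 1%N -> exp_decay +oo p.
Proof.
move=> m1; have [c [a [c0 ha]]] := speed_lower.
exists c => // k; have [C C0 hC] := bigO_pow_derivatives k.
pose u x := - (p x * expR (c * x)).
have ud (x : R) : is_derive x 1 u (- (dp x + c * p x) * expR (c * x)).
  have ed : is_derive x (1 : R) (fun y => expR (c * y)) (expR (c * x) * c).
    by apply: is_derive1_cmp; exact: is_derive1_linear.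
  apply: (is_derive_eq (is_derive1N (is_derive1M (pd x) ed))).
  ring.
have pa x : a <= x -> p x <= p a * expR (c * a) * expR (- (c * x)).
  move=> ax; rewrite expRN ler_pdivlMr ?expR_gt0// -lerN2.
  apply: (derive_ge0_le ax (fun y _ => ud y)) => y /andP[ay _].
  rewrite mulr_ge0 ?expR_ge0//; have := ha y (ltW ay).
  by rewrite m1 expr1; lra.
exists (C * (p a * expR (c * a))); first by rewrite !mulr_gt0// expR_gt0.
near=> x.
have x0 : 0 <= x by near: x; apply: nbhs_pinfty_ge; exact: num_real.
have ax : a <= x by near: x; apply: nbhs_pinfty_ge; exact: num_real.
have : `|derive1n k p x| <= C * p x ^+ (1 + k * (m - 1)) by near: x.
rewrite m1 subnn muln0 addn0 expr1 (ger0_norm x0) => /le_trans; apply.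
by rewrite -mulrA ler_pM2l// pa.
Unshelve. all: by end_near. Qed.

(** For m > 1, the derivative of p^(1-m) is (1-m) p^(-m) dp, which is bounded
below by a positive constant: p^(m-1) is O(1/x). The k-th derivative is
O(p * (p^(m-1))^k), and each factor p^(m-1) supplies one negative power of x. *)
Lemma alg_decay_front : (1 < m)%N -> alg_decay +oo ((m%:R - 1)^-1) p.
Proof.
move=> m1; have [c [a [c0 ha]]] := speed_lower.
pose e := (m - 1)%N; have e0 : (0 < e)%N by rewrite subn_gt0.
have me : m = e.+1 by rewrite /e subn1 prednK.
have eR : m%:R - 1 = e%:R :> R by rewrite me -natr1 addrK.
have eR0 : e%:R != 0 :> R by rewrite pnatr_eq0 -lt0n.
rewrite eR => k; have [C C0 hC] := bigO_pow_derivatives k.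
pose u x := (p x)^-1 ^+ e - c * x.
have ud (x : R) : is_derive x 1 u (- (e%:R * dp x / p x ^+ m) - c).
  have id : is_derive x (1 : R) (fun y => (p y)^-1) (- (p x) ^- 2 * dp x).
    by apply: is_derive1V; rewrite ?gt_eqF.
  have lin := is_derive1N (is_derive1_linear c x).
  apply: (is_derive_eq (is_derive1D (is_derive1X e id) lin)).
  have px : p x != 0 by rewrite gt_eqF.
  have -> : p x ^+ m = p x ^+ 2 * p x ^+ e.-1.
    by rewrite -exprD; congr (_ ^+ _); rewrite me add2n prednK.
  rewrite exprVn.
  have : p x ^+ e.-1 != 0 by rewrite expf_neq0.
  by move=> pe; field; rewrite px pe.
have pe x : a <= x -> c * (x - a) <= (p x)^-1 ^+ e.
  move=> ax; have /(_ ax) : a <= x -> u a <= u x.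
    move=> {}ax; apply: (derive_ge0_le ax (fun y _ => ud y)) => y /andP[ay _].
    have pm : 0 < p y ^+ m by rewrite exprn_gt0.
    have : c <= - dp y / p y ^+ m by rewrite ler_pdivlMr// ha// ltW.
    have : 1 <= e%:R :> R by rewrite ler1n.
    rewrite -mulrA -mulrN -mulNr.
    nra.
  rewrite /u; have : 0 <= (p a)^-1 ^+ e by rewrite exprn_ge0// invr_ge0 ltW.
  lra.
pose K := 2 / c; have K0 : 0 < K by rewrite divr_gt0.
pose nu : R := e%:R^-1.
exists (C * (K `^ nu * K ^+ k)).
  by rewrite !mulr_gt0 ?powR_gt0 ?exprn_gt0.
near=> x.
have x0 : 0 <= x by near: x; apply: nbhs_pinfty_ge; exact: num_real.
have ax : a <= x by near: x; apply: nbhs_pinfty_ge; exact: num_real.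
(* beyond 2 a + 1, the lower bound x - a is at least (1 + x) / 2 *)
have ax2 : 2 * a + 1 <= x by near: x; apply: nbhs_pinfty_ge; exact: num_real.
have y0 : 0 < 1 + x by rewrite ltr_wpDr.
have : `|derive1n k p x| <= C * p x ^+ (1 + k * (m - 1)) by near: x.
rewrite (ger0_norm x0) => /le_trans; apply.
rewrite -mulrA ler_pM2l//.
have peK : p x ^+ e <= K * (1 + x)^-1.
  have := pe x ax; rewrite exprVn => pex.
  rewrite -[leLHS]invrK /K -[leRHS]invrK.
  rewrite lef_pV2 ?posrE ?invr_gt0 ?exprn_gt0//; last first.
    by rewrite mulr_gt0// invr_gt0.
  rewrite !invfM !invrK; apply: le_trans pex; nra.
have pnu : p x <= K `^ nu * (1 + x) `^ (- nu).
  have pE : p x = (p x ^+ e) `^ nu.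
    by rewrite -powR_mulrn ?(ltW (p_gt0 x))// -powRrM mulfV// powRr1// ltW.
  rewrite [leLHS]pE -[- nu]mulN1r powRrM powR_inv1 ?(ltW y0)//.
  rewrite -powRM ?invr_ge0 ?(ltW y0) ?(ltW K0)//.
  apply: ge0_ler_powR peK; rewrite ?nnegrE ?invr_ge0 ?ler0n ?exprn_ge0 ?ltW//.
  by rewrite mulr_gt0// invr_gt0.
rewrite powRD ?(gt_eqF y0) ?implybT// powR_invn ?(ltW y0)//.
rewrite mulrACA exprD expr1 mulnC exprM -/e.
rewrite ler_pM ?exprn_ge0 ?(ltW (p_gt0 x))// -exprVn -exprMn.
by rewrite lerXn2r// ?nnegrE ?exprn_ge0 ?mulr_ge0 ?invr_ge0 ?ltW.
Unshelve. all: by end_near. Qed.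

Lemma front_decay_pos : front_decay +oo m p.
Proof. by split; [exact: exp_decay_front|exact: alg_decay_front]. Qed.

End Decay.

(** * Autonomous first order equations *)

(** The integrand may blow up at lo and hi, so the integrals start from the
midpoint; near a given x they are compared with an integral over a compact
subinterval, to which the fundamental theorem applies. *)
Lemma primitive_on_open_interval (R : realType) (h : R -> R) (lo hi : R) :
  lo < hi -> (forall x, lo < x < hi -> {for x, continuous h}) ->
  exists G : R -> R, forall x, lo < x < hi -> is_derive x 1 G (h x).
Proof.
move=> lohi hc; pose c := (lo + hi) / 2.
have [loc chi] : lo < c /\ c < hi by rewrite /c; split; lra.
pose J s t := \int[lebesgue_measure]_(r in `[s, t]) h r.
exists (fun x => J c x - J x c) => x xin; have /andP[lox xhi] := xin.
have [a [loa ax ac]] : exists a, [/\ lo < a, a < x & a < c].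
  have [xc|cx] := leP x c; first by exists ((lo + x) / 2); split; lra.
  by exists ((lo + c) / 2); split; lra.
have [u [uhi xu cu]] : exists u, [/\ u < hi, x < u & c < u].
  have [xc|cx] := leP x c; first by exists ((c + hi) / 2); split; lra.
  by exists ((x + hi) / 2); split; lra.
have hint : lebesgue_measure.-integrable `[a, u] (EFin \o h).
  apply: continuous_compact_integrable; first exact: segment_compact.
  apply: continuous_in_subspaceT => z; rewrite inE/= in_itv/= => /andP[az zu].
  by apply: hc; rewrite (lt_le_trans loa)// (le_lt_trans zu).
have hJ s t : a <= s -> s <= t -> t <= u -> J a t - J a s = J s t.
  move=> as_ st tu.
  have hat : lebesgue_measure.-integrable `[a, t] (EFin \o h).
    by apply: integrableS hint => //; apply: subset_itvl; rewrite bnd_simp.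
  rewrite /J Rintegral_itvB ?bnd_simp//.
  rewrite Rintegral_itv_obnd_cbnd//.
  by apply: integrableS hat => //; apply: subset_itvr; rewrite bnd_simp.
have J0 s t : t < s -> J s t = 0.
  by move=> ts; rewrite /J set_itv_ge ?Rintegral_set0// bnd_simp -ltNge.
have Ga : \forall y \near x, J a y - J a c = J c y - J y c.
  near=> y.
  have ay : a <= y by apply: ltW; near: y; exact: lt_nbhsr.
  have yu : y <= u by apply: ltW; near: y; exact: lt_nbhsl.
  have [yc|cy|->] := ltgtP y c; last by rewrite !subrr.
    by rewrite (J0 c y)// -(hJ y c) ?(ltW yc) ?(ltW cu)// sub0r opprB.
  by rewrite (J0 y c)// subr0 hJ// ltW.
apply: near_eq_is_derive Ga _.
have [dJ vJ] := continuous_FTC1_closed xu hint ax (hc x xin).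
rewrite -[h x]subr0; apply: is_derive1D.
by rewrite -vJ; exact: derivable_is_derive1.
Unshelve. all: by end_near. Qed.

(** Since 1/q >= 1 / (K (hi - y)), the function G grows at least as fast as
- ln (hi - y) / K. *)
Lemma primitive_unbounded (R : realType) (q G : R -> R) (lo hi K : R) :
  lo < hi -> 0 < K ->
  (forall y, lo < y < hi -> 0 < q y <= K * (hi - y)) ->
  (forall y, lo < y < hi -> is_derive y 1 G (q y)^-1) ->
  forall xi, exists2 y, lo < y < hi & xi <= G y.
Proof.
move=> lohi K0 hq dG xi; pose c := (lo + hi) / 2.
have [loc chi] : lo < c /\ c < hi by rewrite /c; split; lra.
pose phi y := G y + K^-1 * ln (hi - y).
(* close enough to hi for - ln d / K to make up for the gap xi - phi c *)
pose d := Num.min (hi - c) (expR (K * (phi c - xi))).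
have d0 : 0 < d by rewrite lt_min expR_gt0 subr_gt0 chi.
have cd : c <= hi - d by rewrite lerBrDr -lerBrDl ge_min lexx.
have hid : lo < hi - d < hi by rewrite (lt_le_trans loc cd) ltrBlDr ltrDl.
exists (hi - d) => //.
have dphi y : c <= y <= hi - d ->
    is_derive y 1 phi ((q y)^-1 - (K * (hi - y))^-1).
  move=> /andP[cy yd].
  have yin : lo < y < hi.
    by rewrite (lt_le_trans loc cy) (le_lt_trans yd)//; case/andP: hid.
  have y1 : 0 < hi - y by rewrite subr_gt0; case/andP: yin.
  have dy :=
    is_derive1D (is_derive1_cst y hi) (is_derive1N (is_derive1_idfun y)).
  have dl := @is_derive1_cmp _ (@ln R) _ y _ _ (is_derive1_ln y1) dy.
  have Kl := is_derive1M (is_derive1_cst y K^-1) dl.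
  apply: (is_derive_eq (is_derive1D (dG y yin) Kl)).
  by rewrite mul0r add0r sub0r mulrN1 mulrN invfM.
have : phi c <= phi (hi - d).
  apply: (derive_ge0_le cd dphi) => y /andP[cy yd].
  have yin : lo < y < hi.
    by rewrite (lt_trans loc cy) (lt_trans yd)//; case/andP: hid.
  have /andP[q0 qK] := hq y yin.
  by rewrite subr_ge0 lef_pV2// posrE// (lt_le_trans q0).
rewrite {2}/phi subKr.
have : K^-1 * ln d <= phi c - xi.
  rewrite mulrC ler_pdivrMr// mulrC -[leRHS]expRK ler_ln ?posrE ?expR_gt0//.
  by rewrite ge_min lexx orbT.
lra.
Qed.

Section Autonomous.
Context {R : realType} (q : R -> R) (lo hi : R).
Context (lohi : lo < hi).
Context (qc : forall y, lo < y < hi -> {for y, continuous q}).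
Context (q0 : forall y, lo < y < hi -> 0 < q y).

(** G y is the time at which a solution of v' = q (v) passes at y. *)
Lemma travel_time : exists2 G : R -> R,
  (forall y, lo < y < hi -> is_derive y 1 G (q y)^-1) &
  forall y z, lo < y < hi -> lo < z < hi -> G y <= G z -> y <= z.
Proof.
have [|G dG] := @primitive_on_open_interval R (fun y => (q y)^-1) lo hi lohi.
  move=> y yin; apply: continuousV; last exact: qc.
  by rewrite gt_eqF// q0.
exists G => // y z /andP[ly yh] /andP[lz zh]; apply: contraTT.
rewrite -!ltNge => zy; apply: (derive_gt0_lt zy (fun x _ => dG x _)).
  by move=> x /andP[zx xy]; rewrite (lt_le_trans lz)//= (le_lt_trans xy).
move=> x /andP[zx xy].
by rewrite invr_gt0 q0// (lt_trans lz)//= (lt_trans xy).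
Qed.

(** Along a solution the travel time grows at unit speed, so two solutions
differ by a shift of time. *)
Lemma autonomous_unique (v v' : R -> R) :
  (forall x, lo < v x < hi) -> (forall x, lo < v' x < hi) ->
  (forall x : R, is_derive x 1 v (q (v x))) ->
  (forall x : R, is_derive x 1 v' (q (v' x))) ->
  exists h, forall x, v' x = v (x + h).
Proof.
move=> vin v'in dv dv'; have [G dG Gle] := travel_time.
have Gv (u : R -> R) : (forall x, lo < u x < hi) ->
    (forall x : R, is_derive x 1 u (q (u x))) ->
    forall x, G (u x) = G (u 0) + x.
  move=> uin du x; suff : G (u x) - x = G (u 0) - 0 by rewrite subr0; lra.
  apply: (@is_derive_0_is_cst _ (fun x => G (u x) - x)) => {}x.
  have Gu := @is_derive1_cmp _ G u _ _ _ (dG _ (uin x)) (du x).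
  apply: (is_derive_eq (is_derive1D Gu (is_derive1N (is_derive1_idfun x)))).
  by rewrite mulVf ?subrr// gt_eqF// q0.
exists (G (v' 0) - G (v 0)) => x.
have e : G (v' x) = G (v (x + (G (v' 0) - G (v 0)))).
  by rewrite (Gv v')// (Gv v)//; lra.
by apply/eqP; rewrite eq_le; apply/andP; split; apply: Gle => //; rewrite e.
Qed.

(** The travel time is a bijection from ]lo, hi[ onto the line, because q is at
most linear at both ends; the solution is its inverse. *)
Lemma autonomous_exists (K : R) : 0 < K ->
  (forall y, lo < y < hi -> q y <= K * (hi - y)) ->
  (forall y, lo < y < hi -> q y <= K * (y - lo)) ->
  exists v : R -> R, [/\ forall x, lo < v x < hi,
    forall x : R, is_derive x 1 v (q (v x)),
    v x @[x --> -oo] --> lo & v x @[x --> +oo] --> hi].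
Proof.
move=> K0 qhi qlo; have [G dG Gle] := travel_time.
have up xi : exists2 y, lo < y < hi & xi <= G y.
  by apply: (primitive_unbounded lohi K0 _ dG) => y yin; rewrite q0// qhi.
(* the reflected equation, on ]- hi, - lo[, has travel time y |-> - G (- y) *)
have down xi : exists2 y, lo < y < hi & G y <= xi.
  have hilo : - hi < - lo by rewrite ltrN2.
  have flip y : - hi < y < - lo -> lo < - y < hi.
    by rewrite ltrNl => /andP[-> /=]; rewrite ltrNr => ->.
  have qN y : - hi < y < - lo -> 0 < q (- y) <= K * (- lo - y).
    move=> /flip yin; rewrite q0//= addrC.
    exact: qlo.
  have GN y : - hi < y < - lo ->
      is_derive y 1 (fun y => - G (- y)) (q (- y))^-1.
    move=> /flip yin.
    have nG := @is_derive1_cmp _ G -%R _ _ _ (dG _ yin)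
      (is_derive1N (is_derive1_idfun y)).
    apply: (is_derive_eq (is_derive1N nG)).
    by rewrite mulrN1 opprK.
  have [y /flip yin xiy] := primitive_unbounded hilo K0 qN GN (- xi).
  by exists (- y) => //; rewrite -lerN2.
have surj xi : exists y, lo < y < hi /\ G y = xi.
  have [a /andP[loa ahi] Ga] := down xi; have [b /andP[lob bhi] Gb] := up xi.
  have ab : a <= b by apply: Gle; rewrite ?loa ?lob// (le_trans Ga).
  have [||c] := @IVT _ G a b xi ab.
  - apply: derivable_within_continuous => z; rewrite in_itv/= => /andP[az zb].
    apply: is_derive1_derivable; apply: dG.
    by rewrite (lt_le_trans loa)//= (le_lt_trans zb).
  - by rewrite ge_min Ga/= le_max Gb orbT.
  rewrite in_itv/= => /andP[ac cb] Gc; exists c; split=> //.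
  by rewrite (lt_le_trans loa)//= (le_lt_trans cb).
have [v vP] := choice surj.
have vin x : lo < v x < hi by case: (vP x).
have Gv x : G (v x) = x by case: (vP x).
have vG y : lo < y < hi -> v (G y) = y.
  move=> yin; apply/eqP; rewrite eq_le.
  by apply/andP; split; apply: Gle => //; rewrite Gv.
have near_in y : lo < y < hi -> \forall z \near y, lo < z < hi.
  by move=> /andP[ly yh]; near=> z; apply/andP; split; near: z;
    [exact: lt_nbhsr|exact: lt_nbhsl].
have [lom mhi] : lo < (lo + hi) / 2 /\ (lo + hi) / 2 < hi.
  by move: lohi => ?; split; lra.
exists v; split=> // [x||].
- have qv : (q (v x))^-1 != 0 by rewrite invr_eq0 gt_eqF// q0.
  rewrite -[X in is_derive X]Gv -[q _]invrK; apply: is_derive_inverse qv => //.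
  + by apply: filterS (near_in _ (vin x)) => z; exact: vG.
  + apply: filterS (near_in _ (vin x)) => z zin.
    exact: is_derive1_continuous (dG z zin).
  + exact: dG.
- apply/cvgrPdist_le => e e0; pose y := Num.min (lo + e) ((lo + hi) / 2).
  have yin : lo < y < hi.
    by rewrite lt_min gt_min ltrDl e0 lom mhi orbT.
  near=> x; have /andP[lv vh] := vin x.
  rewrite ltr0_norm ?subr_lt0// opprB lerBlDl.
  apply: (@le_trans _ _ y); last by rewrite ge_min lexx.
  apply: Gle => //; rewrite Gv; near: x; apply: nbhs_ninfty_le; exact: num_real.
- apply/cvgrPdist_le => e e0; pose y := Num.max (hi - e) ((lo + hi) / 2).
  have yin : lo < y < hi.
    by rewrite gt_max lt_max ltrBlDr ltrDl e0 lom mhi orbT.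
  near=> x; have /andP[lv vh] := vin x.
  rewrite gtr0_norm ?subr_gt0// lerBlDr -lerBlDl.
  apply: (@le_trans _ _ y); first by rewrite le_max lexx.
  apply: Gle => //; rewrite Gv; near: x; apply: nbhs_pinfty_ge; exact: num_real.
Unshelve. all: by end_near. Qed.

End Autonomous.

(** * Limits along a monotone front *)

(** Applied at both wells: it bounds f - f(v_well) by a square, hence its square
root by a linear function. *)
Lemma critical_point_le (R : realType) (h : nat -> R -> R) (lo hi : R) :
  derivative_tower h -> lo <= hi ->
  exists2 M, 0 < M & forall a y, lo <= a <= hi -> lo <= y <= hi ->
    h 1%N a = 0 -> h 0%N y - h 0%N a <= M * (y - a) ^+ 2.
Proof.
move=> hT lohi.
have [|c _ cmax] := EVT_max (f := h 2%N) lohi.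
  exact/continuous_subspaceT/tower_continuous.
pose M := `|h 2%N c| + 1; exists M; first by rewrite ltr_wpDl.
have hM x : lo <= x <= hi -> h 2%N x <= M.
  move=> xin; rewrite (le_trans (cmax x _)) ?in_itv//.
  by rewrite (le_trans (ler_norm _))// lerDl.
have M0 : 0 < M by rewrite ltr_wpDl.
have slope k r r' : k <= M -> 0 <= r <= r' -> k * r <= M * r'.
  move=> kM /andP[r0 rr']; apply: (@le_trans _ _ (M * r)).
    exact: ler_wpM2r.
  by rewrite ler_pM2l.
move=> a y /andP[loa ahi] /andP[loy yhi] ha.
have [ay|ya|->] := ltgtP a y; last by rewrite !subrr expr0n mulr0.
  have [b /andP[ab by_] e0] := mean_value ay (fun x _ => hT 0%N x).
  have [d /andP[ad db] e1] := mean_value ab (fun x _ => hT 1%N x).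
  have := hM d; rewrite (ltW (le_lt_trans loa ad)) => /(_ _)/=.
  rewrite (ltW (lt_trans db (lt_le_trans by_ yhi))) => /(_ isT) hd.
  move: e1; rewrite ha subr0 e0 => ->.
  rewrite expr2 mulrA; apply: ler_wpM2r; first by rewrite subr_ge0 ltW.
  by apply: slope => //; apply/andP; split; lra.
have [b /andP[yb ba] e0] := mean_value ya (fun x _ => hT 0%N x).
have [d /andP[bd da] e1] := mean_value ba (fun x _ => hT 1%N x).
have := hM d; rewrite (ltW (le_lt_trans loy (lt_trans yb bd))) => /(_ _)/=.
rewrite (ltW (lt_le_trans da ahi)) => /(_ isT) hd.
move: e1; rewrite ha sub0r => e1.
have -> : h 0%N y - h 0%N a = h 2%N d * (a - b) * (a - y).
  by rewrite -e1; lra.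
rewrite -sqrrN opprB expr2 mulrA.
apply: ler_wpM2r; first by rewrite subr_ge0 ltW.
by apply: slope => //; apply/andP; split; lra.
Qed.

(** By the mean value theorem u (x + 1) - u x is a value of du beyond x, and
this difference tends to 0. *)
Lemma derive_cvg0 (R : realType) (u du : R -> R) (l L : R) :
  (forall x : R, is_derive x 1 u (du x)) ->
  u x @[x --> +oo] --> l -> du x @[x --> +oo] --> L -> L = 0.
Proof.
move=> dul ul duL; apply/eqP; rewrite -normr_eq0 eq_le normr_ge0 andbT.
apply/ler_addgt0Pr => e e0; rewrite add0r.
have e3 : 0 < e / 3 by rewrite divr_gt0.
have [a ha] : exists a : R, forall x, a <= x ->
    `|l - u x| <= e / 3 /\ `|L - du x| <= e / 3.
  apply/near_pinftyP; near=> x; split; near: x.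
    by move/cvgrPdist_le : ul; apply.
  by move/cvgrPdist_le : duL; apply.
have [|c /andP[ac _]] := @mean_value _ u du a (a + 1) _ (fun x _ => dul x).
  by rewrite ltrDl.
rewrite [a + 1 - a]addrAC subrr add0r mulr1 => e1.
have [ua _] := ha a (lexx _).
have [|ua1 _] := ha (a + 1); first by rewrite lerDl.
have [_ duc] := ha c (ltW ac).
move: ua ua1 duc; rewrite -e1 !ler_norml => /andP[? ?] /andP[? ?] /andP[? ?].
apply/andP; split; lra.
Unshelve. all: by end_near. Qed.

Lemma increasing_lt_limit (R : realType) (u du : R -> R) (l : R) :
  (forall x : R, is_derive x 1 u (du x)) -> (forall x, 0 < du x) ->
  u x @[x --> +oo] --> l -> forall x, u x < l.
Proof.
move=> dul du0 ul x.
have inc y z : y < z -> u y < u z.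
  by move=> yz; apply: (derive_gt0_lt yz (fun x _ => dul x)).
apply: (lt_le_trans (inc x (x + 1) _)); first by rewrite ltrDl.
rewrite leNgt; apply/negP => lu.
have [a ha] : exists a : R, forall y, a <= y -> u y < u (x + 1).
  by apply/near_pinftyP; exact: (cvgr_lt _ ul).
pose y := Num.max a (x + 2).
have := ha y; rewrite le_max lexx => /(_ isT).
apply/negP; rewrite -leNgt; apply/ltW/inc.
by rewrite lt_max ltrD2l ltr1n orbT.
Qed.

(** The speed is the square root of E (u), so it converges; a convergent
function whose derivative converges has derivative tending to 0. *)
Lemma speed_vanishes (R : realType) (u du E : R -> R) (l : R) :
  (forall x : R, is_derive x 1 u (du x)) -> (forall x, 0 < du x) ->
  (forall x, du x ^+ 2 = E (u x)) -> {for l, continuous E} ->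
  u x @[x --> +oo] --> l -> du x @[x --> +oo] --> (0 : R) /\ E l = 0.
Proof.
move=> dul du0 duE Ec ul.
have El : E (u x) @[x --> +oo] --> E l.
  by apply: cvg_comp ul _; exact: Ec.
have dus : du x @[x --> +oo] --> Num.sqrt (E l).
  rewrite (_ : du = fun x => Num.sqrt (E (u x))); last first.
    by apply/funext => x; rewrite -duE sqrtr_sqr gtr0_norm.
  exact: continuous_cvg (@sqrt_continuous _ _) El.
have s0 := derive_cvg0 dul ul dus.
rewrite s0 in dus; split=> //.
have dus2 : du x * du x @[x --> +oo] --> (0 : R) * 0 by exact: cvgM.
rewrite mulr0 in dus2; apply: norm_cvg_unique dus2.
rewrite (_ : (fun x => du x * du x) = fun x => E (u x)) //.
by apply/funext => x; rewrite -duE expr2.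
Qed.

(** * First integral of the front and speed in a double well *)

(** The left end is reduced to the right one through the reflected front
x |-> - v (- x), which is increasing again. *)
Lemma front_first_integral (R : realType) (h : nat -> R -> R) (v dv : R -> R)
    (sigma lo hi : R) : derivative_tower h ->
  (forall x : R, is_derive x 1 v (dv x)) ->
  (forall x : R, is_derive x 1 dv (h 1%N (v x) - sigma)) ->
  (forall x, 0 < dv x) ->
  v x @[x --> -oo] --> lo -> v x @[x --> +oo] --> hi -> h 1%N hi = 0 ->
  [/\ sigma = 0, h 0%N hi = h 0%N lo, forall x, lo < v x < hi &
    forall x, dv x ^+ 2 = 2 * (h 0%N (v x) - h 0%N lo)].
Proof.
move=> hT vd dvd dv0 vlo vhi hhi.
pose P y := 2 * (h 0%N y - sigma * y).
have dP (y : R) : is_derive y 1 P (2 * (h 1%N y - sigma)).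
  have dl := is_derive1D (hT 0%N y) (is_derive1N (is_derive1_linear sigma y)).
  apply: (is_derive_eq (is_derive1M (is_derive1_cst y 2) dl)).
  by rewrite mul0r add0r.
pose E y := P y + (dv 0 ^+ 2 - P (v 0)).
have dvE x : dv x ^+ 2 = E (v x).
  suff : dv x ^+ 2 - P (v x) = dv 0 ^+ 2 - P (v 0) by rewrite /E => <-; lra.
  apply: (@is_derive_0_is_cst _ (fun x => dv x ^+ 2 - P (v x))) => {}x.
  have dPv := @is_derive1_cmp _ P v _ _ _ (dP (v x)) (vd x).
  apply: (is_derive_eq (is_derive1D (is_derive1X 2 (dvd x)) (is_derive1N dPv))).
  by rewrite expr1; ring.
have Ec : continuous E.
  move=> y.
  exact: is_derive1_continuous (is_derive1D (dP y) (is_derive1_cst y _)).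
have [dv_cvg Ehi] := speed_vanishes vd dv0 dvE (Ec hi) vhi.
pose u x := - v (- x).
have ud (x : R) : is_derive x 1 u (dv (- x)).
  have vN := @is_derive1_cmp _ v -%R _ _ _ (vd _)
    (is_derive1N (is_derive1_idfun x)).
  by apply: (is_derive_eq (is_derive1N vN)); rewrite mulrN1 opprK.
have u_cvg : u x @[x --> +oo] --> - lo by apply: cvgN; apply/cvgNy_compNP.
have duE x : dv (- x) ^+ 2 = E (- u x) by rewrite dvE opprK.
have ENc : {for - lo, continuous (fun y => E (- y))}.
  by apply: continuous_comp; [exact: opp_continuous|exact: Ec].
have [_ Elo] := speed_vanishes ud (fun x => dv0 (- x)) duE ENc u_cvg.
rewrite opprK in Elo.
have sigma0 : sigma = 0.
  have ddv_cvg : h 1%N (v x) - sigma @[x --> +oo] --> h 1%N hi - sigma.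
    apply: cvgB; last exact: cvg_cst.
    apply: cvg_comp vhi _; exact: tower_continuous.
  have := derive_cvg0 dvd dv_cvg ddv_cvg; rewrite hhi; lra.
move: Ehi Elo; rewrite /E /P sigma0 !mul0r !subr0 => Ehi Elo.
split=> // [|x|x]; first by lra.
  rewrite (increasing_lt_limit vd dv0 vhi) andbT.
  have := increasing_lt_limit ud (fun x => dv0 (- x)) u_cvg (- x).
  by rewrite /u opprK ltrN2.
by rewrite dvE /E /P sigma0 !mul0r !subr0; lra.
Qed.

Lemma double_well_gt (R : realType) (f : R -> R) (vm vs vp : R) :
  double_well f vm vs vp -> vm < vs -> vs < vp -> f vp = f vm ->
  forall y, vm < y < vp -> f vm < f y.
Proof.
move=> hf hms hsp fE y /andP[my yp].
have fT := smooth_tower (dw_smooth hf).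
have [ys|sy] := leP y vs.
  apply: (derive_gt0_lt my (fun x _ => fT 0%N x)) => x /andP[mx xy].
  by apply: (dw_incr hf); rewrite mx (lt_le_trans xy).
rewrite -fE -ltrN2.
apply: (derive_gt0_lt yp (fun x _ => is_derive1N (fT 0%N x))) => x /andP[yx xp].
by rewrite oppr_gt0; apply: (dw_decr hf); rewrite (lt_trans sy).
Qed.

(** The speed prescribed at height y by a total energy equal to that of the well
vm. *)
Definition front_speed {R : realType} (f : R -> R) (vm y : R) : R :=
  Num.sqrt (2 * (f y - f vm)).

Section FrontSpeed.
Context {R : realType} (f : R -> R) (vm vs vp : R).
Context (hf : double_well f vm vs vp) (hms : vm < vs) (hsp : vs < vp).
Context (fE : f vp = f vm).
Let q := front_speed f vm.
Let fT := smooth_tower (dw_smooth hf).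

Lemma front_speed_gt0 y : vm < y < vp -> 0 < q y.
Proof.
by move=> yin; rewrite sqrtr_gt0 mulr_gt0// subr_gt0 (double_well_gt hf).
Qed.

Lemma front_speed_continuous : continuous q.
Proof.
move=> y; apply: continuous_comp; last exact: sqrt_continuous.
have df := is_derive1D (fT 0%N y) (is_derive1_cst y (- f vm)).
exact: is_derive1_continuous (is_derive1M (is_derive1_cst y 2) df).
Qed.

Lemma front_speed_le : derive1 f vm = 0 -> derive1 f vp = 0 ->
  exists2 K, 0 < K & forall y, vm < y < vp ->
    q y <= K * (vp - y) /\ q y <= K * (y - vm).
Proof.
move=> f'm f'p; have vmp : vm <= vp by rewrite ltW// (lt_trans hms).
have [M M0 hM] := critical_point_le fT vmp.
exists (1 + M); first by rewrite addr_gt0.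
have sq a y : vm <= a <= vp -> vm < y < vp -> derive1 f a = 0 -> f a = f vm ->
    q y <= (1 + M) * `|y - a|.
  move=> ain /andP[my yp] fa fam.
  have M1 : 0 <= 1 + M by rewrite addr_ge0// ltW.
  rewrite -[1 + M]ger0_norm// -normrM -sqrtr_sqr ler_wsqrtr//.
  have yin : vm <= y <= vp by rewrite !ltW.
  have := hM a y ain yin fa; rewrite /= fam exprMn => fy.
  have : (2 * M) * (y - a) ^+ 2 <= (1 + M) ^+ 2 * (y - a) ^+ 2.
    by rewrite ler_wpM2r ?sqr_ge0//; nra.
  lra.
move=> y yin; have /andP[my yp] := yin; split.
  have := sq vp y; rewrite lexx vmp ltr0_norm ?subr_lt0// opprB.
  by apply.
have := sq vm y; rewrite lexx vmp gtr0_norm ?subr_gt0//.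
by apply.
Qed.

(** A solution of the first order equation solves the Newton equation
v'' = f' (v), by the chain rule for the square root. *)
Lemma front_speed_accel (v : R -> R) (x : R) : vm < v x < vp ->
  is_derive x 1 v (q (v x)) ->
  is_derive x 1 (fun x => q (v x)) (derive1 f (v x)).
Proof.
move=> vin vd.
have X0 : 0 < 2 * (f (v x) - f vm).
  by rewrite mulr_gt0// subr_gt0 (double_well_gt hf).
have fv := @is_derive1_cmp _ f v _ _ _ (fT 0%N (v x)) vd.
have Xd := is_derive1M (is_derive1_cst x 2)
  (is_derive1D fv (is_derive1_cst x (- f vm))).
have sd := @is_derive1_cmp _ (@Num.sqrt R) (fun y => 2 * (f (v y) - f vm))
  _ _ _ (is_derive1_sqrt X0) Xd.
apply: (is_derive_eq sd).
have q0 : q (v x) != 0 by rewrite gt_eqF// front_speed_gt0.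
rewrite mul0r add0r addr0 -[X in X^-1]/(2 * q (v x)) -[f^`(1) _]/(derive1 f _).
by field.
Qed.

End FrontSpeed.

(** * Reduction of the system to the profile equation *)

Lemma ddot_delta (R : realType) (n : nat) (M : 'M[R]_n.+1) :
  ddot M (delta_mx ord0 ord0) = M ord0 ord0.
Proof.
rewrite /ddot (bigD1 ord0)//= (bigD1 ord0)//= mxE !eqxx mulr1.
rewrite !big1 ?addr0// => [i i0|j j0].
  by rewrite big1// => j _; rewrite mxE (negbTE i0) mulr0.
by rewrite mxE (negbTE j0) andbF mulr0.
Qed.

(** Coercivity tested on the matrix whose only nonzero entry is the first. *)
Lemma D1111_gt0 (R : realType) (n : nat) (D : tensor4 R n) :
  elastic_tensor D -> 0 < D1111 D.
Proof.
move=> hD; have [c c0 hc] := elastic_coercive hD.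
have dsym : symmx (delta_mx ord0 ord0 : 'M[R]_n.+1).
  by rewrite /symmx trmx_delta.
have := hc _ dsym; rewrite /frob !ddot_delta !mxE !eqxx sqrtr1 expr1n mulr1.
move=> /(lt_le_trans c0); rewrite -/(ddot (D ord0 ord0) (delta_mx ord0 ord0)).
by rewrite ddot_delta.
Qed.

Lemma stress11E (R : realType) (n : nat) (D : tensor4 R n)
    (eps0 eps1 : 'M[R]_n.+1) (T11 w v : R) : D1111 D != 0 ->
  T11 = stress11 D eps0 eps1 w v <->
  w = (T11 + ddot (Dup11 D) eps0) / D1111 D + ddot (Dup11 D) eps1 / D1111 D * v.
Proof. by move=> d0; rewrite /stress11; split=> ->; field. Qed.

Lemma dx_wave (R : realType) (s : R) (g : R -> R) :
  (forall x : R, derivable g x 1) ->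
  dx (fun x t => g (x - s * t)) = fun x t => derive1 g (x - s * t).
Proof.
move=> gd; apply/funext => x; apply/funext => t; apply: is_derive1_val.
have dg := derivable_is_derive1 (gd (x - s * t)).
have dl := is_derive1D (is_derive1_idfun x) (is_derive1_cst x (- (s * t))).
apply: (is_derive_eq (@is_derive1_cmp _ g (fun y => y - s * t) _ _ _ dg dl)).
by rewrite addr0 mulr1.
Qed.

Lemma dt_wave (R : realType) (s : R) (g : R -> R) (x t : R) :
  (forall x : R, derivable g x 1) ->
  dt (fun x t => g (x - s * t)) x t = - s * derive1 g (x - s * t).
Proof.
move=> gd; apply: is_derive1_val.
have dg := derivable_is_derive1 (gd (x - s * t)).
have dl := is_derive1D (is_derive1_cst t x)
  (is_derive1N (is_derive1_linear s t)).
apply: (is_derive_eq (@is_derive1_cmp _ g (fun r => x - s * r) _ _ _ dg dl)).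
by rewrite add0r mulrC.
Qed.

(** Here the factor |v'| cancels, since v' > 0. *)
Lemma solves_system_wave (R : realType) (n : nat) (D : tensor4 R n)
    (eps0 eps1 : 'M[R]_n.+1) (f : R -> R) (T11 s : R) (v w : R -> R)
    (u1 : R -> R -> R) : smooth v -> (forall x, 0 < derive1 v x) ->
  (forall x t : R, is_derive x (1 : R) (fun y => u1 y t) (w (x - s * t))) ->
  solves_system D eps0 eps1 f T11 (fun x t => v (x - s * t)) u1 <->
  forall xi, T11 = stress11 D eps0 eps1 (w xi) (v xi) /\
    derive1 (derive1 v) xi =
      derive1 f (v xi) - (alpha D eps1 * T11 + beta D eps0 eps1 + s).
Proof.
move=> vs v0 u1d; set A := alpha _ _ * _ + _.
have du1 x t : dx u1 x t = w (x - s * t) by exact: is_derive1_val (u1d x t).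
have core x : - s * derive1 v x =
    (A - derive1 f (v x) + derive1 (derive1 v) x) * `|derive1 v x| <->
    derive1 (derive1 v) x = derive1 f (v x) - (A + s).
  rewrite gtr0_norm//; split; last by move=> ->; ring.
  move=> /(mulIf (lt0r_neq0 (v0 x))); lra.
have dxv : dx (fun x t => v (x - s * t)) = _ := dx_wave s (vs 0%N).
have dxxv : dx (fun x t => derive1 v (x - s * t)) = _ := dx_wave s (vs 1%N).
split=> [sol xi|sol x t].
  have := sol xi 0; rewrite dt_wave; last exact: (vs 0%N).
  rewrite dxv dxxv du1 mulr0 subr0 => -[Tw eqv].
  split; [exact: Tw|exact: (core xi).1 eqv].
rewrite dt_wave; last exact: (vs 0%N).
rewrite dxv dxxv du1; have [Tw eqv] := sol (x - s * t).
split; [exact: Tw|exact: (core _).2 eqv].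
Qed.

(** The stress equation passes to the limit at both ends, and subtracting the
two limits gives the jump relation. The conclusion also records the first order
equation, from which uniqueness and decay follow. *)
Lemma wave_relations (R : realType) (n : nat) (D : tensor4 R n)
    (eps0 eps1 : 'M[R]_n.+1) (f : R -> R) (vm vp T11 s wm wp : R)
    (v w : R -> R) : smooth f -> derive1 f vp = 0 -> D1111 D != 0 ->
  traveling_wave D eps0 eps1 f T11 s v w -> monotone_front vm vp wm wp v w ->
  [/\ s = - (alpha D eps1 * T11 + beta D eps0 eps1), f vp = f vm,
      D1111 D * (wp - wm) = ddot (Dup11 D) eps1 * (vp - vm),
      T11 = stress11 D eps0 eps1 wm vm &
      [/\ forall x, T11 = stress11 D eps0 eps1 (w x) (v x),
          forall x : R, is_derive x 1 (derive1 v) (derive1 f (v x)),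
          forall x, vm < v x < vp,
          forall x, derive1 v x ^+ 2 = 2 * (f (v x) - f vm) &
          forall x : R, is_derive x 1 v (front_speed f vm (v x))]].
Proof.
move=> fs f'p d0 [vs ws [u1 [u1d sol]]] [vm_cvg vp_cvg wm_cvg wp_cvg v0].
have {}sol := (solves_system_wave D eps0 eps1 f T11 vs v0 u1d).1 sol.
have Tw x := (sol x).1; have ode x := (sol x).2.
have vd (x : R) : is_derive x 1 v (derive1 v x).
  exact: derivable_is_derive1 (vs 0%N x).
have dvd (x : R) : is_derive x 1 (derive1 v) (derive1 f (v x) -
    (alpha D eps1 * T11 + beta D eps0 eps1 + s)).
  by rewrite -ode; exact: derivable_is_derive1 (vs 1%N x).
have [s0 fE vin dvE] :=
  front_first_integral (smooth_tower fs) vd dvd v0 vm_cvg vp_cvg f'p.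
have w_lim (F : set_system R) (FF : ProperFilter F) (vl wl : R) :
    v x @[x --> F] --> vl -> w x @[x --> F] --> wl ->
    T11 = stress11 D eps0 eps1 wl vl.
  move=> vF wF; apply/stress11E => //; apply: norm_cvg_unique wF _.
  have -> : w = fun x => (T11 + ddot (Dup11 D) eps0) / D1111 D +
      ddot (Dup11 D) eps1 / D1111 D * v x.
    by apply/funext => x; exact: (stress11E _ _ _ _ _ d0).1 (Tw x).
  by apply: cvgD; [exact: cvg_cst|apply: cvgM; [exact: cvg_cst|]].
have Tm : T11 = stress11 D eps0 eps1 wm vm by exact: w_lim vm_cvg wm_cvg.
have Tp : T11 = stress11 D eps0 eps1 wp vp by exact: w_lim vp_cvg wp_cvg.
split=> //.
- by apply/eqP; rewrite -addr_eq0 addrC s0.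
- by move: Tm Tp; rewrite /stress11; lra.
split=> // x; first by have := dvd x; rewrite s0 subr0.
suff -> : front_speed f vm (v x) = derive1 v x by [].
by rewrite /front_speed -[2 * _]dvE sqrtr_sqr gtr0_norm.
Qed.

(** A potential u^1 of w is obtained without integrating w along the front: if P
is a primitive of (b y + c) / q y on ]vm, vp[, then P (v) has derivative
b v + c. *)
Lemma wave_exists (R : realType) (n : nat) (D : tensor4 R n)
    (eps0 eps1 : 'M[R]_n.+1) (f : R -> R) (vm vs vp T11 wm wp : R) :
  double_well f vm vs vp -> vm < vs -> vs < vp ->
  derive1 f vm = 0 -> derive1 f vp = 0 -> D1111 D != 0 -> f vp = f vm ->
  D1111 D * (wp - wm) = ddot (Dup11 D) eps1 * (vp - vm) ->
  T11 = stress11 D eps0 eps1 wm vm ->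
  exists v w, traveling_wave D eps0 eps1 f T11
      (- (alpha D eps1 * T11 + beta D eps0 eps1)) v w /\
    monotone_front vm vp wm wp v w.
Proof.
move=> hf hms hsp f'm f'p d0 fE jump Tm.
have vmp := lt_trans hms hsp.
pose q := front_speed f vm.
have q0 y : vm < y < vp -> 0 < q y by exact: front_speed_gt0 hf hms hsp fE y.
have qc := front_speed_continuous hf.
have [K K0 qK] := front_speed_le hf hms hsp fE f'm f'p.
have [v [vin vd v_lo v_hi]] := autonomous_exists vmp (fun y _ => qc y) q0 K0
  (fun y yin => (qK y yin).1) (fun y yin => (qK y yin).2).
have v'E : derive1 v = fun x => q (v x).
  by apply/funext => x; exact: is_derive1_val (vd x).
have vdd (x : R) : is_derive x 1 (fun x => q (v x)) (derive1 f (v x)).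
  exact: (front_speed_accel hf hms hsp fE (vin x) (vd x)).
have v'_gt0 x : 0 < derive1 v x by rewrite v'E q0.
have f'T : derivative_tower (fun k => derive1n k.+1 f).
  by move=> k x; exact: smooth_tower (dw_smooth hf) k.+1 x.
have vs_ : smooth v := ode_smooth f'T vd vdd.
pose c := (T11 + ddot (Dup11 D) eps0) / D1111 D.
pose b := ddot (Dup11 D) eps1 / D1111 D.
pose w x := b * v x + c.
have Tw x : T11 = stress11 D eps0 eps1 (w x) (v x).
  by apply/(stress11E _ _ _ _ _ d0); rewrite /w addrC.
have wmE : wm = b * vm + c.
  by rewrite addrC; exact: (stress11E _ _ _ _ _ d0).1 Tm.
have wpE : wp = b * vp + c.
  have -> : wp = b * (vp - vm) + wm.
    by rewrite /b mulrAC -jump [_ * (wp - wm)]mulrC mulfK// subrK.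
  by rewrite wmE; ring.
have w_lim (F : set_system R) (FF : Filter F) (l : R) :
    v x @[x --> F] --> l -> w x @[x --> F] --> b * l + c.
  by move=> vl; apply: cvgD; [apply: cvgM; [exact: cvg_cst|]|exact: cvg_cst].
have [W WE] : exists W : R -> R, forall x : R, is_derive x 1 W (w x).
  have [y yin|P Pd] := @primitive_on_open_interval R
      (fun y => (b * y + c) / q y) vm vp vmp.
    apply: continuousM.
      exact: is_derive1_continuous
        (is_derive1D (is_derive1_linear b y) (is_derive1_cst y c)).
    by apply: continuousV; [rewrite gt_eqF// q0|exact: qc].
  exists (fun x => P (v x)) => x.
  apply: (is_derive_eq (@is_derive1_cmp _ P v _ _ _ (Pd _ (vin x)) (vd x))).
  by rewrite /w divfK// gt_eqF// q0.
exists v, w; split; last first.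
  by split=> //; [rewrite wmE|rewrite wpE]; exact: w_lim.
pose s := - (alpha D eps1 * T11 + beta D eps0 eps1).
have u1d x t : is_derive x (1 : R) (fun y => W (y - s * t)) (w (x - s * t)).
  have dl := is_derive1D (is_derive1_idfun x) (is_derive1_cst x (- (s * t))).
  have dW := @is_derive1_cmp _ W (fun y => y - s * t) _ _ _ (WE _) dl.
  by apply: (is_derive_eq dW); rewrite addr0 mulr1.
split=> //.
  exact: tower_smooth (tower_affine_value b c (smooth_tower vs_)).
exists (fun x t => W (x - s * t)); split=> //.
apply/(solves_system_wave D eps0 eps1 f T11 vs_ v'_gt0 u1d) => xi; split=> //.
rewrite /s addrN subr0 v'E; exact: is_derive1_val (vdd xi).
Qed.

(** * Tails of the front *)

(** Carries decay at +oo to either end of the line; t is the identity or the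
reflection in the intended uses. *)
Lemma front_decay_transfer (R : realType) (F : set_system R) (t : R -> R)
    (m : nat) (g p : R -> R) : Filter F ->
  t x @[x --> F] --> +oo -> (forall x, `|t x| = `|x|) ->
  (forall k x, `|derive1n k g x| = `|derive1n k p (t x)|) ->
  front_decay +oo m p -> front_decay F m g.
Proof.
move=> FF tF tn gp [pexp palg]; split=> [/pexp|/palg].
  move=> [c c0 pc]; exists c => // k; have [C C0 pC] := pc k; exists C => //.
  by apply: (@filterS _ F FF _ _ _ (tF _ pC)) => x /=; rewrite gp tn.
move=> pc k; have [C C0 pC] := pc k; exists C => //.
by apply: (@filterS _ F FF _ _ _ (tF _ pC)) => x /=; rewrite gp tn.
Qed.

Lemma oppr_cvg_ninfty (R : realType) :
  - x @[x --> (-oo : set_system R)] --> +oo.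
Proof.
move=> P [a [_ aP]]; exists (- a); split; first exact: num_real.
by move=> x xa; apply: aP; rewrite ltrNr.
Qed.

(** The potential f near its well a, in the coordinate y with value a + s y, and
normalized to vanish at y = 0; with s = 1 or s = -1 the well is approached from
above or from below. The trivial factor 1 matches [tower_affine_value]. *)
Definition well_tower {R : realType} (f : R -> R) (s a : R) : nat -> R -> R :=
  fun k y => 1 * (s ^+ k * derive1n k f (a + s * y)) +
             (if k is 0%N then - f a else 0).

Lemma well_towerP (R : realType) (f : R -> R) (s a : R) :
  smooth f -> derivative_tower (well_tower f s a).
Proof.
move=> fs; apply: tower_affine_value; apply: tower_affine_arg.
exact: smooth_tower.
Qed.

Lemma well_tower_flat (R : realType) (f : R -> R) (s a : R) (m : nat) :
  (0 < m)%N -> s ^+ 2 = 1 -> flat_min f a m ->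
  (forall k, (k < 2 * m)%N -> well_tower f s a k 0 = 0) /\
  0 < well_tower f s a (2 * m) 0.
Proof.
move=> m0 s2 [f0 fpos]; split=> [[|k] km|].
- by rewrite /well_tower expr0 !mul1r mulr0 addr0 subrr.
- rewrite /well_tower mulr0 !addr0 (f0 k.+1) ?mulr0//.
  by rewrite /=; move: km; rewrite subn1; case: (2 * m)%N.
have -> : well_tower f s a (2 * m) 0 = derive1n (2 * m) f a.
  rewrite /well_tower exprM s2 expr1n !mul1r mulr0 addr0.
  by case: m m0 {f0 fpos} => [//|m _]; rewrite mulnS addr0.
exact: fpos.
Qed.

(** The signs s and e select the end: p = s (v (e x) - a) is positive, decreases
to 0 at +oo, and is a trajectory in the potential [well_tower f s a]. *)
Lemma front_tail_decay (R : realType) (f v dv : R -> R) (F : set_system R)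
    (s e a : R) (m : nat) : Filter F ->
  smooth f -> smooth v -> (0 < m)%N -> flat_min f a m ->
  s ^+ 2 = 1 -> e ^+ 2 = 1 ->
  (forall x : R, is_derive x 1 v (dv x)) ->
  (forall x : R, is_derive x 1 dv (derive1 f (v x))) ->
  (forall x, dv x ^+ 2 = 2 * (f (v x) - f a)) ->
  (forall x, 0 < s * (v (e * x) - a)) -> (forall x, s * e * dv (e * x) < 0) ->
  v (e * x) @[x --> +oo] --> a -> e * x @[x --> F] --> +oo ->
  front_decay F m (fun x => v x - a).
Proof.
move=> FF fs vs m0 fm s2 e2 vd dvd dvE p0 dp0 v_cvg eF.
have [h0 hpos] := well_tower_flat m0 s2 fm.
pose p x := s * (v (e * x) - a).
have ve (x : R) : a + s * p x = v (e * x).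
  by rewrite /p mulrA -expr2 s2 mul1r addrC subrK.
have lin (x : R) := is_derive1_linear e x.
have pd (x : R) : is_derive x 1 p (s * e * dv (e * x)).
  have vex := @is_derive1_cmp _ v (fun y => e * y) _ _ _ (vd (e * x)) (lin x).
  have pdx := is_derive1M (is_derive1_cst x s)
    (is_derive1D vex (is_derive1_cst x (- a))).
  by apply: (is_derive_eq pdx); rewrite mul0r add0r addr0 mulrAC mulrA.
have dpd (x : R) : is_derive x 1 (fun x => s * e * dv (e * x))
    (well_tower f s a 1 (p x)).
  have dvex :=
    @is_derive1_cmp _ dv (fun y => e * y) _ _ _ (dvd (e * x)) (lin x).
  apply: (is_derive_eq (is_derive1M (is_derive1_cst x (s * e)) dvex)).
  rewrite /well_tower ve mul0r add0r addr0 mul1r expr1.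
  rewrite -[derive1n 1 f _]/(derive1 f _).
  transitivity (e ^+ 2 * (s * derive1 f (v (e * x)))); first by ring.
  by rewrite e2 mul1r.
have energy x : (s * e * dv (e * x)) ^+ 2 = 2 * well_tower f s a 0 (p x).
  by rewrite !exprMn s2 e2 !mul1r dvE /well_tower ve expr0 !mul1r.
have p_cvg : p x @[x --> +oo] --> (0 : R).
  rewrite -(mulr0 s) -(subrr a); apply: cvgM; first exact: cvg_cst.
  by apply: cvgB => //; exact: cvg_cst.
have pD :=
  front_decay_pos (well_towerP s a fs) m0 h0 hpos pd dpd p0 dp0 energy p_cvg.
have e1 : `|e| = 1.
  apply/eqP; rewrite -(@eqrXn2 _ 2) ?normr_ge0//.
  by rewrite real_normK ?num_real// e2 expr1n.
have s1 : `|s| = 1.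
  apply/eqP; rewrite -(@eqrXn2 _ 2) ?normr_ge0//.
  by rewrite real_normK ?num_real// s2 expr1n.
apply: front_decay_transfer eF _ _ pD => [x|k x].
  by rewrite normrM e1 mul1r.
have vT := smooth_tower vs.
have gT := tower_affine_value 1 (- a) vT.
have pT := tower_affine_value s (- (s * a)) (tower_affine_arg e 0 vT).
have -> : (fun x => v x - a) = (fun y => 1 * v y - a).
  by apply/funext => y; rewrite mul1r.
have -> : p = (fun y => s * (e ^+ 0 * v (0 + e * y)) - s * a).
  by apply/funext => y; rewrite /p expr0 mul1r add0r mulrBr.
rewrite (tower_derive1n gT) (tower_derive1n pT).
have eex : e * (e * x) = x by rewrite mulrA -expr2 e2 mul1r.
rewrite add0r eex.
case: k => [|k]; first by rewrite expr0 !mul1r -mulrBr normrM s1 mul1r.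
by rewrite !addr0 mul1r !normrM normrX s1 e1 expr1n !mul1r.
Qed.

(** * Traveling waves of the non-conservative system *)

(* For a prescribed constant T11 the jump relation determines (w_-, w_+) only
   up to a common additive constant, so the equivalence also records that T11
   is the stress of the left end state (w_-, v_-); with the jump relation it is
   then the stress of the right end state as well. *)
Theorem theorem3p1 (R : realType) (n : nat) (D : tensor4 R n)
    (eps0 eps1 : 'M[R]_n.+1) (f : R -> R) (vm vs vp : R) (m1 m2 : nat) (T11 : R)
    (hD : elastic_tensor D) (heps0 : symmx eps0) (heps1 : symmx eps1)
    (hms : vm < vs) (hsp : vs < vp) (hf : double_well f vm vs vp)
    (hm1 : (0 < m1)%N) (hm2 : (0 < m2)%N)
    (hfp : flat_min f vp m1) (hfm : flat_min f vm m2) :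
  forall s wm wp : R,
    let is_wave (v w : R -> R) :=
      traveling_wave D eps0 eps1 f T11 s v w /\ monotone_front vm vp wm wp v w in
    [/\ (exists v w : R -> R, is_wave v w) <->
        [/\ s = - (alpha D eps1 * T11 + beta D eps0 eps1),
            f vp = f vm,
            D1111 D * (wp - wm) = ddot (Dup11 D) eps1 * (vp - vm)
          & T11 = stress11 D eps0 eps1 wm vm],
        (forall v w v' w' : R -> R, is_wave v w -> is_wave v' w' ->
           exists h : R, forall xi : R, v' xi = v (xi + h) /\ w' xi = w (xi + h))
      & forall v w : R -> R, is_wave v w ->
          front_decay +oo m1 (fun xi => v xi - vp) /\
          front_decay -oo m2 (fun xi => v xi - vm)].
Proof.
move=> s wm wp is_wave.
have fs := dw_smooth hf.
have d0 : D1111 D != 0 by rewrite gt_eqF// D1111_gt0.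
have f'p : derive1 f vp = 0 by apply: (hfp.1 1%N); rewrite subn_gt0; lia.
have f'm : derive1 f vm = 0 by apply: (hfm.1 1%N); rewrite subn_gt0; lia.
have rel v w : is_wave v w -> _ := fun vw => wave_relations fs f'p d0 vw.1 vw.2.
split=> [|v w v' w' vw v'w'|v w vw].
- split=> [[v [w vw]]|[sE fE jump Tm]].
    by have [sE fE jump Tm _] := rel v w vw.
  rewrite /is_wave sE; exact: (wave_exists hf hms hsp f'm f'p d0 fE jump Tm).
- have [_ fE _ _ [Tw _ vin _ vd]] := rel v w vw.
  have [_ _ _ _ [T'w _ v'in _ v'd]] := rel v' w' v'w'.
  have q0 y : vm < y < vp -> 0 < front_speed f vm y.
    exact: (front_speed_gt0 hf hms hsp fE).
  have qc y : vm < y < vp -> {for y, continuous (front_speed f vm)}.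
    by move=> _; exact: (front_speed_continuous hf).
  have [h v'v] := autonomous_unique (lt_trans hms hsp) qc q0 vin v'in vd v'd.
  exists h => xi; split; first exact: v'v.
  by rewrite ((stress11E _ _ _ _ _ d0).1 (T'w xi)) v'v
     -((stress11E _ _ _ _ _ d0).1 (Tw (xi + h))).
- have [_ fE _ _ [_ dvd vin dvE _]] := rel v w vw.
  have [[vs_ _ _] [v_lo v_hi _ _ v0]] := vw.
  have vd (x : R) : is_derive x 1 v (derive1 v x).
    exact: derivable_is_derive1 (vs_ 0%N x).
  split.
    apply: (@front_tail_decay _ f v (derive1 v) +oo (-1) 1) => //.
    + by rewrite sqrrN expr1n.
    + by rewrite expr1n.
    + by move=> x; rewrite dvE fE.
    + by move=> x; rewrite mul1r mulN1r oppr_gt0 subr_lt0; case/andP: (vin x).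
    + by move=> x; rewrite mul1r mulr1 mulN1r oppr_lt0.
    + by under eq_cvg do rewrite mul1r.
    + by under eq_cvg do rewrite mul1r.
  apply: (@front_tail_decay _ f v (derive1 v) -oo 1 (-1)) => //.
  + by rewrite expr1n.
  + by rewrite sqrrN expr1n.
  + by move=> x; rewrite mul1r subr_gt0; case/andP: (vin (-1 * x)).
  + by move=> x; rewrite mul1r mulN1r oppr_lt0.
  + under eq_cvg do rewrite mulN1r.
    exact/cvgNy_compNP.
  + under eq_cvg do rewrite mulN1r.
    exact: oppr_cvg_ninfty.
Qed.
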